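(* Let $\ell,r\in\mathbb{N}$ be powers of $2$ (with $1=2^0$ allowed). Then there exist a countably infinite abelian group $G$ with $[G:2G]=\ell$ and $|\ker(D)|=r$ (where $D:G\to G$, $D(g)=2g$), a Følner sequence $\Phi$ in $G$ which is quasi-invariant with respect to doubling with ratio $\alpha_\Phi=\alpha_G$, and a set $A\subset G$ with $\overline{\mathrm{d}}_\Phi(A)=1-\frac{\alpha_G}{\ell+r}$, for which $B+B\not\subset A$ for any infinite $B\subset G$.
   Context: For $g\in G$, $2g:=g+g$; $2G=\{2g: g\in G\}$. For $C\subset G$, $C/2:=D^{-1}(C)=\{g\in G: 2g\in C\}$. A Følner sequence in $G$ is a sequence $\Phi=(\Phi_N)_{N\in\mathbb{N}}$ of (nonempty) finite subsets of $G$ with $\lim_{N\to\infty}\frac{|\Phi_N\cap(g+\Phi_N)|}{|\Phi_N|}=1$ for every $g\in G$; $\mathcal{F}_G$ is the set of all Følner sequences in $G$. The upper density of $A\subset G$ with respect to $\Phi$ is $\overline{\mathrm{d}}_\Phi(A)=\limsup_{N\to\infty}\frac{|A\cap\Phi_N|}{|\Phi_N|}$. The doubling ratio of $\Phi$ is $\alpha_\Phi=\liminf_{N\to\infty}\frac{|(\Phi_N/2)\cap\Phi_N|}{|\Phi_N|}$; $\Phi$ is quasi-invariant with respect to doubling with ratio $\alpha_\Phi$ if $\alpha_\Phi>0$. The group doubling ratio is $\alpha_G=\sup\{\alpha_\Phi:\Phi\in\mathcal{F}_G\}$. $B+B=\{b_1+b_2: b_1,b_2\in B\}$ (with $b_1=b_2$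 allowed). *)

(* Defs.v *)
From HB Require Import structures.
From mathcomp Require Import all_boot all_order all_algebra.
From mathcomp Require Import finmap.
From mathcomp Require Import all_classical all_reals all_analysis.

Set Implicit Arguments.
Unset Strict Implicit.
Unset Printing Implicit Defensive.

Import Order.TTheory GRing.Theory Num.Theory.
Import numFieldNormedType.Exports.
Local Open Scope classical_set_scope.
Local Open Scope ring_scope.

Section Doubling.
Context (G : zmodType).

Definition doubling (g : G) : G := g + g.

Definition doubles : set G := range doubling.

Definition doubling_ker : set G := doubling @^-1` [set 0].

Definition half (C : set G) : set G := doubling @^-1` C.

Definition sumset (B C : set G) : set G := [set b + c | b in B & c in C].

Definition translate (g : G) (C : set G) : set G := [set g + x | x in C].

Definition cosets (H : set G) : set (set G) := [set translate g H | g in setT].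

End Doubling.

Arguments doubles : clear implicits.
Arguments doubling_ker : clear implicits.

Section Density.
Context (R : realType) (G : zmodType).

Definition ratio_in (C : set G) (F : {fset G}) : R :=
  #|` [fset x in F | x \in C]%fset|%:R / #|` F|%:R.

Definition folner (Phi : nat -> {fset G}) : Prop :=
  (forall N, Phi N != fset0) /\
  (forall g : G,
     ratio_in (translate g [set` Phi N]) (Phi N) @[N --> \oo] --> (1 : R)).

(* The sequences below take values in [0, 1], so the real-valued limsup and
   liminf are the genuine ones, and so is the [sup] defining [group_ratio] as
   soon as G has a Følner sequence. *)
Definition upper_density (Phi : nat -> {fset G}) (A : set G) : R :=
  limn_sup (fun N => ratio_in A (Phi N)).

Definition doubling_ratio (Phi : nat -> {fset G}) : R :=
  limn_inf (fun N => ratio_in (half [set` Phi N]) (Phi N)).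

Definition quasi_invariant (Phi : nat -> {fset G}) : Prop :=
  0 < doubling_ratio Phi.

Definition group_ratio : R :=
  sup [set doubling_ratio Phi | Phi in [set Phi | folner Phi]].

End Density.

Arguments group_ratio : clear implicits.

(* Main.v *)
Require Import Defs.
From HB Require Import structures.
From mathcomp Require Import all_boot all_order all_algebra.
From mathcomp Require Import finmap.
From mathcomp Require Import all_classical all_reals all_analysis.
From mathcomp Require Import ring zify.

Set Implicit Arguments.
Unset Strict Implicit.
Unset Printing Implicit Defensive.

Import Order.TTheory GRing.Theory Num.Theory.
Import numFieldNormedType.Exports.
Local Open Scope classical_set_scope.
Local Open Scope card_scope.
Local Open Scope ring_scope.

(** Let [alpha = min(1, r / l)]. Doubling maps [Phi_N/2 `&` Phi_N] into
    [2G `&` Phi_N] with fibres of size at most [r], and [2G] has density [1 / l]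
    along every Følner sequence, so no doubling ratio exceeds [alpha]
    ([doubling_ratio_le]). It remains to find, for each [l] and [r], a group with
    a Følner sequence of ratio [alpha] and a set [C] of density
    [alpha / (l + r)] that meets [B + B] for every infinite [B]; then [A] is the
    complement of [C].

    Taking the product with an elementary group of order [2 ^ i], and [C] inside
    the first factor, multiplies [l], [r] by [2 ^ i] and divides the density of
    [C] by [2 ^ i]; infinitely many elements of [B] share their second
    coordinate, so their sums have second coordinate 0 ([example_elementary]).
    This leaves three cases.

    - [l = r = 1]: polynomials over the field with 3 elements, where [2p = -p];
      [C] is the set of polynomials with leading coefficient 1. If [x] has larger
      degree than [y], then [x + y] and [x + x] have opposite leading
      coefficients, so one of them is in [C] ([example_poly_F3]).

    - [l = 1] and [r = 2 ^ k]: the [k]-th power of the Prüfer 2-group, with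
      [X_n] the subgroup of elements killed by [2 ^ n]. If [x] is in
      [X_(m+1)] but not in [X_m] and [y] is in [X_m], then [x + y] has the level
      of [x], while [x + x] lies exactly one level lower. So the set [C] of
      elements of odd level is met by [B + B] ([example_prufer_powers]).

    - [l = 2 ^ k] and [r = 1]: integer vectors, with [X_n] the box of vectors with
      coordinates from 0 to [2 ^ n - 1]. Doubling now raises the level by one, and
      [x + y] has the level of [x] unless a coordinate crosses a power of 2.
      After passing to a subset of [B] in a single class modulo [2G], all sums are
      doubles, so [C] can consist of the doubles of the vectors of odd level,
      together with a null set that contains the crossings and with the vectors
      that have a negative coordinate, which the boxes do not meet
      ([example_integer_vectors]).

    In the last two cases [X_n] has [Q ^ n] elements for [Q = 2 ^ k], and the
    alternating sum of these sizes gives the odd levels the share [1 / (Q + 1)]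
    of [X_(2N)] in the limit ([cvg_odd_level]). *)

(** * Counting in finite sets *)

Section Counting.
Context (R : realType).

Lemma card_fset_sep (T : choiceType) (P : {pred T}) (F : {fset T}) :
  #|` [fset x in F | P x]%fset| = count P F.
Proof.
rewrite -size_filter; apply: perm_size; apply: uniq_perm.
- exact: fset_uniq.
- by rewrite filter_uniq ?fset_uniq.
by move=> x; rewrite mem_filter !inE andbC.
Qed.

Lemma count_le_inj (T U : eqType) (f : T -> U) (P : pred T) (Q : pred U)
    (s : seq T) (t : seq U) :
  uniq s -> {in s &, injective f} ->
  (forall x, x \in s -> P x -> f x \in t /\ Q (f x)) ->
  (count P s <= count Q t)%N.
Proof.
move=> us finj fP; rewrite -!size_filter -(size_map f); apply: uniq_leq_size.
  rewrite map_inj_in_uniq ?filter_uniq // => x y.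
  by rewrite !mem_filter => /andP[_ xs] /andP[_ ys]; apply: finj.
move=> _ /mapP[x + ->]; rewrite !mem_filter => /andP[Px xs].
by have [-> ->] := fP x xs Px.
Qed.

Lemma count_eq_inj (T U : eqType) (f : T -> U) (P : pred T) (Q : pred U)
    (s : seq T) (t : seq U) :
  uniq s -> uniq t -> {in s &, injective f} ->
  (forall x, x \in s -> P x -> f x \in t /\ Q (f x)) ->
  (forall y, y \in t -> Q y -> exists2 x, x \in s /\ P x & f x = y) ->
  count P s = count Q t.
Proof.
move=> us ut finj fP fQ; rewrite -!size_filter -(size_map f).
apply: perm_size; apply: uniq_perm.
- rewrite map_inj_in_uniq ?filter_uniq // => x y.
  by rewrite !mem_filter => /andP[_ xs] /andP[_ ys]; apply: finj.
- by rewrite filter_uniq.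
move=> y; apply/mapP/idP.
  by case=> x; rewrite !mem_filter => /andP[Px xs] ->; have [-> ->] := fP x xs Px.
rewrite mem_filter => /andP[Qy yt]; have [x [xs Px] <-] := fQ y yt Qy.
by exists x => //; rewrite mem_filter Px.
Qed.

Lemma ratio_inE (G : zmodType) (C : set G) (F : {fset G}) :
  ratio_in R C F = (count (mem C) F)%:R / #|` F|%:R.
Proof. by rewrite /ratio_in card_fset_sep. Qed.

Variable G : zmodType.
Implicit Types (C D : set G) (F : {fset G}).

Lemma card_fset_neq0 F : F != fset0 -> #|` F|%:R != 0 :> R.
Proof. by move=> F0; rewrite pnatr_eq0 -lt0n cardfs_gt0. Qed.

Lemma ratio_in_ge0 C F : 0 <= ratio_in R C F.
Proof. by rewrite ratio_inE divr_ge0. Qed.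

Lemma ratio_in_mono C D F :
  (forall x, x \in F -> C x -> D x) -> ratio_in R C F <= ratio_in R D F.
Proof.
move=> CD; rewrite !ratio_inE ler_wpM2r ?invr_ge0 // ler_nat.
apply: (@count_le_inj _ _ id) => //; first exact: fset_uniq.
by move=> x xF; rewrite /= !inE => /(CD _ xF).
Qed.

Lemma ratio_in_ext C D F :
  (forall x, x \in F -> C x <-> D x) -> ratio_in R C F = ratio_in R D F.
Proof.
move=> CD; apply/eqP; rewrite eq_le; apply/andP.
by split; apply: ratio_in_mono => x /CD[].
Qed.

Lemma ratio_in_le1 C F : ratio_in R C F <= 1.
Proof.
rewrite ratio_inE; have [->|F0] := eqVneq F fset0.
  by rewrite cardfs0 invr0 mulr0.
by rewrite ler_pdivrMr ?mul1r ?ltr0n ?cardfs_gt0 // ler_nat count_size.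
Qed.

Lemma ratio_in_full C F :
  F != fset0 -> (forall x, x \in F -> C x) -> ratio_in R C F = 1.
Proof.
move=> F0 FC; rewrite ratio_inE (_ : count _ _ = #|` F|).
  by rewrite divff // card_fset_neq0.
by apply/eqP; rewrite -all_count; apply/allP => x /FC; rewrite /= inE.
Qed.

Lemma ratio_inC C F : F != fset0 -> ratio_in R (~` C) F = 1 - ratio_in R C F.
Proof.
move=> F0; apply/eqP; rewrite eq_sym subr_eq eq_sym !ratio_inE -mulrDl -natrD.
rewrite (_ : (_ + _)%N = #|` F|) ?divff ?card_fset_neq0 //.
rewrite -(count_predC (mem C)) addnC; congr (_ + _)%N.
by apply: eq_count => x; rewrite /= in_setC.
Qed.

Lemma ratio_inU_le C D F :
  ratio_in R (C `|` D) F <= ratio_in R C F + ratio_in R D F.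
Proof.
rewrite !ratio_inE -mulrDl ler_wpM2r ?invr_ge0 // -natrD ler_nat -count_predUI.
rewrite (leq_trans _ (leq_addr _ _)) //; apply: sub_count => x /=.
by rewrite in_setU.
Qed.

End Counting.

(** * The doubling ratio of an arbitrary Følner sequence *)

Section Index.
Variable G : zmodType.

(** A finite type of labels serves better than a cardinal as a record of the
    index of 2G and of the size of the kernel of doubling: for products and
    powers of groups, the labels are the products and powers. *)
Definition index_labels (T : finType) : Prop :=
  exists2 p : G -> T, (forall t, exists x, p x = t) &
    (forall x y, p x = p y <-> doubles G (x - y)).

Definition kernel_labels (K : finType) : Prop :=
  exists2 k : K -> G, injective k &
    (forall x, x + x = 0 <-> exists t, k t = x).

Lemma card_finType (T : finType) : [set: T] #= `I_#|T|.
Proof.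
apply: (card_eq_trans _ (card_esym card_II)).
rewrite (_ : [set: 'I__] = enum_rank @` [set: T]).
  by apply/card_esym/inj_card_eq => x y _ _; exact: enum_rank_inj.
by apply/seteqP; split=> // i _; exists (enum_val i); rewrite ?enum_valK.
Qed.

Lemma doubles0 : doubles G 0.
Proof. by exists 0 => //; rewrite /doubling addr0. Qed.

Lemma doublesD x y : doubles G x -> doubles G y -> doubles G (x + y).
Proof.
move=> [a _ <-] [b _ <-]; exists (a + b) => //.
by rewrite /doubling addrACA.
Qed.

Lemma doublesN x : doubles G x -> doubles G (- x).
Proof. by move=> [a _ <-]; exists (- a); rewrite // /doubling opprD. Qed.

Lemma card_cosets T : index_labels T -> cosets (doubles G) #= `I_#|T|.
Proof.
case=> p psurj pP.
pose g t : G := sval (cid (psurj t)).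
have gP t : p (g t) = t by rewrite /g; case: cid.
rewrite (_ : cosets _ = (fun t => translate (g t) (doubles G)) @` [set: T]).
  apply: (card_eq_trans _ (card_finType T)); apply: inj_card_eq.
  move=> s t _ _ /(congr1 (fun A => A (g s))) E.
  have : translate (g t) (doubles G) (g s).
    by rewrite -E; exists 0; rewrite ?addr0 //; exact: doubles0.
  case=> x xD gx; rewrite -(gP s) -(gP t); apply/pP.
  by rewrite -gx addrAC subrr add0r.
apply/seteqP; split=> [_ [x _ <-]|_ [t _ <-]]; last by exists (g t).
exists (p x) => //.
have xg : doubles G (x - g (p x)) by apply/pP; rewrite gP.
apply/seteqP; split=> _ [y yD <-].
  exists (g (p x) - x + y); last by rewrite addrA addrCA subrr addr0.
  by rewrite -opprB; apply: doublesD => //; exact: doublesN.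
exists (x - g (p x) + y); last by rewrite addrA addrCA subrr addr0.
exact: doublesD.
Qed.

Lemma card_doubling_ker K : kernel_labels K -> doubling_ker G #= `I_#|K|.
Proof.
case=> k kinj kP.
rewrite (_ : doubling_ker G = k @` [set: K]).
  apply: (card_eq_trans _ (card_finType K)); apply: inj_card_eq.
  by move=> s t _ _; exact: kinj.
apply/seteqP; split=> [x /kP[t <-]|_ [t _ <-]]; first by exists t.
by apply/kP; exists t.
Qed.

Variables (R : realType) (T K : finType).
Hypotheses (GT : index_labels T) (GK : kernel_labels K).

(** Doubling maps [Phi/2 `&` Phi] into [2G `&` Phi], with fibres that are
    contained in cosets of the kernel. *)
Lemma ratio_half_le (F : {fset G}) :
  ratio_in R (Defs.half [set` F]) F <= #|K|%:R * ratio_in R (doubles G) F.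
Proof.
case: GK => k kinj kP; rewrite !ratio_inE mulrA ler_wpM2r ?invr_ge0 //.
rewrite -natrM ler_nat.
pose s y : G := xget 0 [set x | doubling x = y].
have sP x : exists t, s (doubling x) + k t = x.
  have /kP[t kt] : x - s (doubling x) + (x - s (doubling x)) = 0.
    have E : doubling (s (doubling x)) = doubling x.
      by apply: (@xgetPex _ 0 [set z | doubling z = doubling x]); exists x.
    by rewrite addrACA -opprD -/(doubling (s _)) E subrr.
  by exists t; rewrite kt addrCA subrr addr0.
rewrite mulnC cardT -!size_filter -(size_allpairs (fun y t => s y + k t)).
apply: uniq_leq_size; first by rewrite filter_uniq ?fset_uniq.
move=> x; rewrite mem_filter => /andP[/set_mem dxF xF].
have [t E] := sP x; apply/allpairsP; exists (doubling x, t).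
split=> //=; last by rewrite mem_enum.
by rewrite mem_filter /= dxF andbT inE; exists x.
Qed.

(** Translation by a representative [- g t] of a coset of 2G moves
    [2G `&` Phi] into that coset, and out of [Phi] only where [Phi] fails to be
    invariant, so no coset has a share much smaller than that of 2G. *)
Lemma ratio_doubles_le : exists g : T -> G, forall F : {fset G}, F != fset0 ->
  #|T|%:R * ratio_in R (doubles G) F
    <= 1 + \sum_t (1 - ratio_in R (translate (g t) [set` F]) F).
Proof.
case: GT => p psurj pP.
pose g t : G := sval (cid (psurj t)).
have gP t : p (g t) = t by rewrite /g; case: cid.
exists (fun t => - g t) => F F0.
have class t : ratio_in R (doubles G) F
    <= ratio_in R [set x | p x = t] F
       + (1 - ratio_in R (translate (- g t) [set` F]) F).
  rewrite -ratio_inC //.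
  have split_F : ratio_in R (doubles G) F <=
      ratio_in R (doubles G `&` translate (- g t) [set` F]) F
      + ratio_in R (~` translate (- g t) [set` F]) F.
    apply: le_trans (ratio_inU_le _ _ _ _); apply: ratio_in_mono => x _ xD.
    by have [?|?] := pselect (translate (- g t) [set` F] x); [left|right].
  apply: le_trans split_F _; rewrite lerD2r !ratio_inE.
  rewrite ler_wpM2r ?invr_ge0 // ler_nat.
  apply: (@count_le_inj _ _ (+%R (g t))); first exact: fset_uniq.
    by move=> x y _ _; exact: addrI.
  move=> x xF /=; rewrite !inE => -[xD [y yF yx]]; split.
    by rewrite -yx addrA subrr add0r.
  rewrite /= -[RHS](gP t); apply/pP.
  by rewrite addrAC subrr add0r.
have sum_class : \sum_t ratio_in R [set x | p x = t] F = 1.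
  under eq_bigr do rewrite ratio_inE.
  rewrite -mulr_suml -natr_sum (_ : (\sum_t _)%N = #|` F|).
    by rewrite divff // card_fset_neq0.
  under eq_bigr do rewrite -sum1_count.
  rewrite -sum1_size (exchange_big_dep xpredT) //=; apply: eq_bigr => x _.
  rewrite (big_pred1 (p x)) // => t.
  by apply/idP/eqP; rewrite inE => ->.
rewrite mulr_natl -sumr_const -[X in _ <= X + _]sum_class -big_split /=.
by apply: ler_sum => t _; exact: class.
Qed.

Lemma limn_inf_le (u v : R^nat) (c : R) :
  (forall n, 0 <= u n <= 1) -> (forall n, u n <= v n) -> v @ \oo --> c ->
  limn_inf u <= c.
Proof.
move=> u01 uv vc.
have lbu : has_lbound (range u) by exists 0 => _ [n _ <-]; case/andP: (u01 n).
have ubu : has_ubound (range u) by exists 1 => _ [n _ <-]; case/andP: (u01 n).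
have infs_le n : infs u n <= v n.
  apply: le_trans (uv n); apply: inf_lbound; last by exists n => /=.
  by exists 0 => _ [m _ <-]; case/andP: (u01 m).
rewrite /limn_inf -(cvg_lim _ vc) //; apply: ler_lim.
- by apply/cvg_ex; eexists; exact: cvg_infs_sup.
- by apply/cvg_ex; exists c.
- by near=> n; exact: infs_le.
Unshelve. all: by end_near. Qed.

(** In [ratio_doubles_le] each error term is the defect of translation by one
    fixed element, so it tends to 0, and the upper density of 2G is at most
    [1 / #|T|]. *)
Lemma doubling_ratio_le (Phi : nat -> {fset G}) : folner R Phi ->
  doubling_ratio R Phi <= Num.min 1 (#|K|%:R / #|T|%:R).
Proof.
move=> [Phi0 PhiF]; have [g gP] := ratio_doubles_le.
have T_gt0 : 0 < #|T|%:R :> R.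
  rewrite ltr0n; case: GT => p _ _.
  by apply/card_gt0P; exists (p 0).
have u01 N : 0 <= ratio_in R (Defs.half [set` Phi N]) (Phi N) <= 1.
  by rewrite ratio_in_ge0 ratio_in_le1.
rewrite le_min; apply/andP; split.
  apply: (@limn_inf_le _ (fun=> 1)) => //; last exact: cvg_cst.
  by move=> N; case/andP: (u01 N).
pose v N := #|K|%:R / #|T|%:R *
  (1 + \sum_t (1 - ratio_in R (translate (g t) [set` Phi N]) (Phi N))).
apply: (@limn_inf_le _ v) => //.
  move=> N; apply: le_trans (ratio_half_le _) _.
  rewrite /v -mulrA ler_wpM2l // mulrC ler_pdivlMr // mulrC.
  exact: gP.
rewrite -[X in _ --> X]mulr1; apply: cvgM; first exact: cvg_cst.
rewrite -[X in _ --> X]addr0; apply: cvgD; first exact: cvg_cst.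
rewrite [X in _ --> X](_ : _ = \sum_(t : T) (1 - 1)); last first.
  by rewrite big1 // => t _; rewrite subrr.
apply: cvg_big => [|t _]; first exact: add_continuous.
by apply: cvgB; [exact: cvg_cst|exact: PhiF].
Qed.

End Index.

(** * What an example has to satisfy *)

(** For every group of index [#|T|] and kernel size [#|K|] this bounds the doubling
    ratios; in the examples below it is the group doubling ratio. *)
Definition best_ratio (R : realType) (T K : finType) : R :=
  Num.min 1 (#|K|%:R / #|T|%:R).

(** [C] is the complement of the set of the theorem: its density has to be
    [alpha / (l + r)], and it has to meet [B + B] for every infinite [B]. *)
Record doubling_example (R : realType) (G : zmodType) (T K : finType)
    (Phi : nat -> {fset G}) (C : set G) : Prop := DoublingExample {
  example_countable : countable [set: G];
  example_infinite : infinite_set [set: G];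
  example_index : index_labels G T;
  example_kernel : kernel_labels G K;
  example_folner : folner R Phi;
  example_half : ratio_in R (Defs.half [set` Phi N]) (Phi N) @[N --> \oo] -->
    best_ratio R T K;
  example_density : ratio_in R C (Phi N) @[N --> \oo] -->
    best_ratio R T K / (#|T| + #|K|)%:R;
  example_sumset : forall B : set G, infinite_set B ->
    exists x y, [/\ B x, B y & C (x + y)] }.

Section FromExample.
Variables (R : realType) (G : zmodType) (T K : finType).
Variables (Phi : nat -> {fset G}) (C : set G).
Hypothesis ex : doubling_example R T K Phi C.

Lemma example_doubling_ratio :
  doubling_ratio R Phi = best_ratio R T K.
Proof. exact: (cvg_limn_inf_sup (example_half ex)).1. Qed.

(** [Phi] attains the general bound, so the supremum is a maximum. *)
Lemma example_group_ratio : group_ratio R G = best_ratio R T K.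
Proof.
have ub : ubound [set doubling_ratio R P | P in [set P : nat -> {fset G} | folner R P]]
    (best_ratio R T K).
  move=> _ [P PF <-].
  exact: doubling_ratio_le (example_index ex) (example_kernel ex) _ PF.
have attained : [set doubling_ratio R P | P in [set P : nat -> {fset G} | folner R P]]
    (best_ratio R T K).
  by exists Phi; [exact: example_folner ex|exact: example_doubling_ratio].
apply/eqP; rewrite eq_le; apply/andP; split.
  by apply: ge_sup => //; eexists; exact: attained.
by apply: ub_le_sup => //; eexists; exact: ub.
Qed.

Lemma theorem_of_example : exists (G : zmodType) (Phi : nat -> {fset G}) (A : set G),
    [/\ [set: G] #= [set: nat],
        cosets (doubles G) #= `I_#|T| &
        doubling_ker G #= `I_#|K|] /\
    [/\ folner R Phi,
        quasi_invariant R Phi &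
        doubling_ratio R Phi = group_ratio R G] /\
    upper_density R Phi A = 1 - group_ratio R G / (#|T| + #|K|)%:R /\
    (forall B : set G, infinite_set B -> ~ (sumset B B `<=` A)).
Proof.
exists G, Phi, (~` C); split; [split|split; [split|split]].
- exact: eq_card_nat (example_countable ex) (example_infinite ex).
- exact: card_cosets (example_index ex).
- exact: card_doubling_ker (example_kernel ex).
- exact: example_folner ex.
- rewrite /quasi_invariant example_doubling_ratio /best_ratio lt_min ltr01 divr_gt0 //.
    case: (example_kernel ex) => k _ kP.
    by have [t _] := (kP 0).1 (addr0 0); rewrite ltr0n; apply/card_gt0P; exists t.
  by case: (example_index ex) => p _ _; rewrite ltr0n; apply/card_gt0P; exists (p 0).
- by rewrite example_doubling_ratio example_group_ratio.
- rewrite example_group_ratio /upper_density.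
  rewrite (_ : (fun N => _) = (fun N => 1 - ratio_in R C (Phi N))).
    exact: (cvg_limn_inf_sup (cvgB (cvg_cst (1 : R)) (example_density ex))).2.
  by apply/funext => N; rewrite ratio_inC //; case: (example_folner ex).
- move=> B /(example_sumset ex)[x [y [Bx By Cxy]]] /(_ (x + y)).
  by apply => //; exists x => //; exists y.
Qed.

End FromExample.

(** * Products with a finite elementary 2-group *)

Section Product.
Variables (R : realType) (G V : zmodType).

Lemma count_fsetM (P : pred G) (Q : pred V) (F : {fset G}) (E : {fset V}) :
  count (fun z => P z.1 && Q z.2) (F `*` E)%fset = (count P F * count Q E)%N.
Proof.
rewrite -!size_filter -(size_allpairs pair); apply: perm_size; apply: uniq_perm.
- by rewrite filter_uniq ?fset_uniq.
- apply: allpairs_uniq; rewrite ?filter_uniq ?fset_uniq //.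
  by move=> [a b] [c d] _ _ [-> ->].
move=> [x v]; rewrite mem_filter in_fsetM /=; apply/idP/allpairsP => /=.
  move=> /andP[/andP[Px Qv] /andP[xF vE]].
  by exists (x, v); rewrite !mem_filter Px xF Qv vE.
case=> -[y w] /=; rewrite !mem_filter => -[/andP[Py yF] /andP[Qw wE] [-> ->]].
by rewrite Py Qw yF.
Qed.

Lemma ratio_inX (C : set G) (D : set V) (F : {fset G}) (E : {fset V}) :
  ratio_in R (C `*` D) (F `*` E)%fset = ratio_in R C F * ratio_in R D E.
Proof.
rewrite !ratio_inE mulrACA -invfM -!natrM.
congr (_%:R / _%:R).
  rewrite -count_fsetM; apply: eq_count => z /=.
  by rewrite in_setX.
rewrite -(count_predT F) -(count_predT E) -count_fsetM.
by rewrite -[LHS]count_predT; apply: eq_count.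
Qed.

Lemma fsetM_neq0 (F : {fset G}) (E : {fset V}) :
  F != fset0 -> E != fset0 -> (F `*` E)%fset != fset0.
Proof.
move=> /fset0Pn[x xF] /fset0Pn[v vE]; apply/fset0Pn; exists (x, v).
by rewrite in_fsetM xF.
Qed.

End Product.

Section ElementaryFactor.
Variables (R : realType) (G : zmodType) (T K : finType).
Variables (Phi : nat -> {fset G}) (C : set G) (i : nat).
Hypothesis ex : doubling_example R T K Phi C.
Let V := 'rV['F_2]_i.
Let allV : {fset V} := [fset v in {: V}]%fset.

Let addVV (v : V) : v + v = 0.
Proof.
apply/matrixP => a b; rewrite !mxE -mulr2n -mulr_natr.
by rewrite (_ : 2%:R = 0) ?mulr0 //; apply: val_inj.
Qed.

Let allV_neq0 : allV != fset0.
Proof. by apply/fset0Pn; exists 0; rewrite !inE. Qed.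

(** Any two elements of the factor [V] with the same value add up to 0 there, so
    only the sums with second coordinate 0 have to be avoided; this is what
    divides the density of [C] by [#|V|], as required by the new value of
    [#|T| + #|K|]. *)
Lemma example_elementary : doubling_example R (T * V)%type (K * V)%type
  (fun N => (Phi N `*` allV)%fset) (C `*` [set 0]).
Proof.
have [p psurj pP] := example_index ex.
have [k kinj kP] := example_kernel ex.
have card_V : #|V|%:R != 0 :> R.
  by rewrite pnatr_eq0 -lt0n; apply/card_gt0P; exists 0.
have card_allV : #|` allV| = #|V|.
  rewrite cardE; apply: perm_size; apply: uniq_perm; rewrite ?fset_uniq ?enum_uniq //.
  by move=> v; rewrite !inE mem_enum.
have same_ratio : best_ratio R (T * V)%type (K * V)%type = best_ratio R T K.
  rewrite /best_ratio; congr Num.min.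
  by rewrite !card_prod !natrM -mulf_div divff // mulr1.
split.
- rewrite -setXTT; apply: countableX; first exact: example_countable ex.
  exact: countableP.
- rewrite -setXTT => fin; apply: (example_infinite ex).
  apply: sub_finite_set (finite_image fst fin) => x _; by exists (x, 0).
- exists (fun z => (p z.1, z.2)) => [[t v]|[x v] [y w]].
    by have [x xt] := psurj t; exists (x, v); rewrite /= xt.
  split=> [[/pP[z _ xyz] ->]|[[z u] _]].
    exists (z, 0) => //; rewrite /doubling in xyz *.
    by congr (_, _); rewrite /= ?xyz ?subrr ?addr0.
  rewrite /doubling => -[xyz vw]; congr (_, _) => /=.
    by apply/pP; exists z.
  by apply/eqP; rewrite -subr_eq0 -vw addVV.
- exists (fun z => (k z.1, z.2)) => [[s v] [t w] [/kinj -> ->] //|[x v]].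
  split=> [[xx _]|[[t w] [<- <-]]].
    by have [t <-] := (kP x).1 xx; exists (t, v).
  by congr (_, _) => //=; rewrite ?addVV //; apply/kP; exists t.
- split=> [N|[g v]].
    by apply: fsetM_neq0 => //; case: (example_folner ex).
  have [_ /(_ g)] := example_folner ex; apply: cvg_trans.
  apply: near_eq_cvg; near=> N.
  rewrite -[LHS]mulr1 -(@ratio_in_full R V setT allV) // -ratio_inX.
  apply: ratio_in_ext => -[x w] _ /=; split.
    move=> [[y yF yx] _]; exists (y, w - v); last first.
      by congr (_, _); rewrite //= addrC subrK.
    by rewrite /= in_fsetM /= yF !inE.
  by case=> -[y u] /=; rewrite in_fsetM => /andP[/= yF _] [<- _]; split=> //; exists y.
- rewrite same_ratio; apply: cvg_trans (example_half ex).
  apply: near_eq_cvg; near=> N.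
  rewrite -[LHS]mulr1 -(@ratio_in_full R V setT allV) // -ratio_inX.
  apply: ratio_in_ext => -[x w] _.
  by rewrite /= /Defs.half /= in_fsetM /= !inE andbT; split => // -[].
- rewrite same_ratio !card_prod -mulnDl natrM invfM mulrA.
  under eq_cvg do rewrite ratio_inX.
  apply: cvgM; first exact: example_density ex.
  rewrite (_ : ratio_in R _ _ = #|V|%:R^-1); first exact: cvg_cst.
  rewrite ratio_inE card_allV (_ : count _ _ = 1%N) ?mul1r //.
  rewrite (eq_count (a2 := pred1 0)) => [|v]; last first.
    by apply/idP/eqP; rewrite inE.
  by rewrite count_uniq_mem ?fset_uniq // !inE.
- move=> B Binf.
  (* [V] is finite, so infinitely many elements of [B] agree there *)
  have [v vinf] : exists v, infinite_set [set x | B (x, v)].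
    apply: contrapT => /forallNP fin; apply: Binf.
    apply: (@sub_finite_set _ _
      (\bigcup_(v in [set: V]) ((pair^~ v) @` [set x | B (x, v)]))).
      by move=> [x v] Bxv; exists v => //; exists x.
    apply: bigcup_finite => [|v _]; first exact: finite_finset.
    by apply: finite_image; apply: contrapT; exact: fin.
  have [x [y [Bx By Cxy]]] := example_sumset ex vinf.
  by exists (x, v), (y, v); split=> //; split=> //=; exact: addVV.
Unshelve. all: by end_near. Qed.

End ElementaryFactor.

(** * Towers of finite subgroups *)

Section Tower.
Variables (R : realType) (G : zmodType) (S : nat -> {fset G}).
Hypotheses (S0 : forall n, 0 \in S n).
Hypotheses (SB : forall n x y, x \in S n -> y \in S n -> x - y \in S n).
Hypotheses (Sexh : forall x, \forall n \near \oo, x \in S n).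

Let S_neq0 n : S n != fset0.
Proof. by apply/fset0Pn; exists 0. Qed.

Let SD n x y : x \in S n -> y \in S n -> x + y \in S n.
Proof. by move=> xS yS; rewrite -[y]opprK SB // -sub0r SB. Qed.

(** A fixed element lies in all but finitely many of the subgroups, and
    translation by a member preserves a subgroup. *)
Lemma folner_tower : folner R S.
Proof.
split=> // g; apply: cvg_near_cst; apply: filterS (Sexh g) => n gS.
rewrite (@ratio_in_full R) // => x xS.
by exists (x - g); [exact: SB|rewrite addrC subrK].
Qed.

Lemma ratio_half_tower n : ratio_in R (Defs.half [set` S n]) (S n) = 1.
Proof. by apply: ratio_in_full => // x xS; exact: SD. Qed.

End Tower.

Lemma cvg_invXn (R : realType) (q : nat) : (1 < q)%N ->
  ((q ^ n)%:R^-1 : R) @[n --> \oo] --> (0 : R).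
Proof.
move=> q1; have := @cvg_geometric R 1 q%:R^-1.
rewrite /geometric /= => H; apply: cvg_trans (H _).
  by apply: near_eq_cvg; near=> n; rewrite /= mul1r natrX exprVn.
by rewrite ger0_norm ?invr_ge0 // invf_lt1 ?ltr0n ?ltr1n // (ltn_trans _ q1).
Unshelve. all: by end_near. Qed.

(** * Index one and trivial kernel: polynomials over the field with 3 elements *)

Section PolyF3.
Variable R : realType.
Let G := {poly 'F_3}.

Definition poly_le (n : nat) : {fset G} := [fset rVpoly v | v : 'rV['F_3]_n]%fset.

Lemma mem_poly_le n p : (p \in poly_le n) = (size p <= n)%N.
Proof.
apply/imfsetP/idP => [[v _ ->]|pn]; first exact: size_poly.
by exists (poly_rV p); rewrite ?poly_rV_K.
Qed.

Lemma card_poly_le n : #|` poly_le n| = (3 ^ n)%N.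
Proof.
rewrite card_in_imfset /=; last by move=> u v _ _; exact: (can_inj (@rVpolyK _ n)).
by rewrite -cardE card_mx card_Fp // mul1n.
Qed.

Lemma F3_cases (c : 'F_3) : [\/ c = 0, c = 1 | c = -1].
Proof.
by case: c => -[|[|[|//]]] i; [apply: Or31|apply: Or32|apply: Or33]; apply: val_inj.
Qed.

(** Opposition exchanges the leading coefficients 1 and -1 and leaves out only
    the zero polynomial. *)
Lemma count_lead1 n :
  (count (fun p : G => lead_coef p == 1) (poly_le n)).*2.+1 = (3 ^ n)%N.
Proof.
have by_lead (s : seq G) : size s = (count (fun p => lead_coef p == 1%R) s +
    (count (fun p => (lead_coef p == -1)%R) s + count (pred1 0%R) s))%N.
  elim: s => //= p s ->; rewrite -(lead_coef_eq0 p).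
  by have [-> | -> | ->] := F3_cases (lead_coef p); rewrite /= ?addSn ?addnS.
rewrite -card_poly_le by_lead count_uniq_mem ?fset_uniq //.
rewrite mem_poly_le size_poly0 addn1 addnS -addnn; congr (_ + _).+1.
apply: (@count_eq_inj _ _ -%R); rewrite ?fset_uniq //.
- by move=> p q _ _; exact: oppr_inj.
- by move=> p; rewrite !mem_poly_le size_polyN lead_coefN => -> /eqP ->.
move=> p; rewrite mem_poly_le => pn /eqP l1; exists (- p); rewrite ?opprK //.
by rewrite mem_poly_le size_polyN lead_coefN l1 opprK.
Qed.

(** Since [p + p = - p], doubling negates the leading coefficient, whereas adding
    a polynomial of smaller degree preserves it. *)
Lemma example_poly_F3 :
  doubling_example R unit unit poly_le [set p : G | lead_coef p = 1].
Proof.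
have tower_zero n : (0 : G) \in poly_le n by rewrite mem_poly_le size_poly0.
have tower_sub n (p q : G) : p \in poly_le n -> q \in poly_le n -> p - q \in poly_le n.
  rewrite !mem_poly_le => pn qn; apply: leq_trans (size_polyD _ _) _.
  by rewrite size_polyN geq_max pn.
have tower_exhausts (p : G) : \forall n \near \oo, p \in poly_le n.
  by near=> n; rewrite mem_poly_le; near: n; exact: nbhs_infty_ge.
have double (p : G) : p + p = - p.
  apply/eqP; rewrite -addr_eq0 -mulr2n -mulrSr -scaler_nat.
  by rewrite (_ : 3%:R = 0) ?scale0r //; apply: val_inj.
have best1 : best_ratio R unit unit = 1.
  by rewrite /best_ratio divff ?card_unit // minxx.
split.
- exact: countableP.
- apply/infinite_set_fsetP => n; exists (poly_le n) => //.
  by rewrite card_poly_le ltnW // ltn_expl.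
- exists (fun=> tt) => [[]|p q]; first by exists 0.
  by split=> // _; exists (q - p) => //; rewrite /doubling double opprB.
- exists (fun=> 0) => [[] [] //|p]; split=> [|[_ <-]]; last by rewrite addr0.
  by rewrite double => /eqP; rewrite oppr_eq0 => /eqP ->; exists tt.
- exact: folner_tower.
- rewrite best1; apply: cvg_near_cst; apply: nearW => n.
  exact: ratio_half_tower.
- rewrite best1 card_unit.
  have lim : ((1 - (3 ^ N)%:R^-1) / 2 : R) @[N --> \oo] --> (1 / (1 + 1)%:R : R).
    rewrite -[X in X / _]subr0; apply: cvgM; last exact: cvg_cst.
    by apply: cvgB; [exact: cvg_cst|exact: cvg_invXn].
  apply: cvg_trans lim.
  apply: near_eq_cvg; near=> N; rewrite ratio_inE card_poly_le /=.
  rewrite (eq_count (a2 := fun p : G => lead_coef p == 1)) => [|p]; last first.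
    by apply/idP/eqP; rewrite inE.
  have E := congr1 (fun m : nat => m%:R : R) (count_lead1 N).
  rewrite -E -muln2 -addn1 natrD natrM.
  have q0 : ((3 ^ N)%:R : R) != 0 by rewrite pnatr_eq0 expn_eq0.
  rewrite -E -muln2 -addn1 natrD natrM in q0.
  by field.
- move=> B Binf; have [y By] := infinite_setN0 Binf.
  have [x [Bx yx]] : exists x, B x /\ (size y < size x)%N.
    apply: contrapT => /forallNP small; apply: Binf.
    apply: sub_finite_set (finite_fset (poly_le (size y))) => x Bx.
    rewrite /= mem_poly_le leqNgt; apply/negP => yx; exact: (small x).
  have lx : lead_coef (x + y) = lead_coef x by rewrite lead_coefDl.
  have [|l1|l1] := F3_cases (lead_coef x).
  + by move/eqP; rewrite lead_coef_eq0 => /eqP x0; rewrite x0 size_poly0 in yx.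
  + by exists x, y; rewrite /= lx.
  + by exists x, x; rewrite /= double lead_coefN l1 opprK.
Unshelve. all: by end_near. Qed.

End PolyF3.

(** * Powers of a group *)

Section Power.
Variables (R : realType) (G : zmodType) (k : nat).

Definition pow_fset (F : {fset G}) : {fset {ffun 'I_k -> G}} :=
  [fset x in [seq [ffun i => val (f i)] | f : {ffun 'I_k -> F}]]%fset.

Lemma mem_pow_fset F x : (x \in pow_fset F) = [forall i, x i \in F].
Proof.
rewrite inE /=; apply/mapP/forallP => [[f _ ->] i|xF].
  by rewrite ffunE; exact: valP.
exists [ffun i => [` xF i]%fset]; first by rewrite mem_enum.
by apply/ffunP => i; rewrite !ffunE.
Qed.

Lemma count_pow_fset (P : 'I_k -> pred G) (F : {fset G}) :
  count (fun x : {ffun 'I_k -> G} => [forall i, P i (x i)]) (pow_fset F) =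
  (\prod_i count (P i) F)%N.
Proof.
pose Q i : pred F := fun u => P i (val u).
transitivity #|family Q|.
  rewrite cardE -size_filter -(size_map (fun f : {ffun 'I_k -> F} => [ffun i => val (f i)])).
  apply: perm_size; apply: uniq_perm.
  - by rewrite filter_uniq ?fset_uniq.
  - rewrite map_inj_uniq ?enum_uniq // => f g /ffunP fg; apply/ffunP => i.
    by apply: val_inj; have := fg i; rewrite !ffunE.
  move=> x; rewrite mem_filter mem_pow_fset; apply/idP/mapP.
    move=> /andP[/forallP Px /forallP xF].
    exists [ffun i => [` xF i]%fset]; last by apply/ffunP => i; rewrite !ffunE.
    by rewrite mem_enum; apply/familyP => i; rewrite ffunE; exact: Px.
  case=> f; rewrite mem_enum => /familyP fQ ->.
  by apply/andP; split; apply/forallP => i; rewrite ffunE; [exact: fQ|exact: valP].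
rewrite card_family foldrE big_map -big_enum /=.
by apply: eq_bigr => i _; rewrite cardE enum_fsetE count_map -size_filter enumT.
Qed.

Lemma card_pow_fset F : #|` pow_fset F| = (#|` F| ^ k)%N.
Proof.
rewrite -[LHS]count_predT.
rewrite (eq_count (a2 := fun x : {ffun 'I_k -> G} => [forall i, predT (x i)])); last first.
  by move=> x; apply/esym/forallP.
rewrite (count_pow_fset (fun=> predT)) (eq_bigr (fun=> #|` F|)) => [|i _].
  by rewrite prod_nat_const card_ord.
exact: count_predT.
Qed.

(** Densities of boxes in a power of the group reduce to densities in one
    coordinate; translates, halves and, through complements, null sets of the
    power are all handled in this way. *)
Lemma ratio_in_pow (C : 'I_k -> set G) (F : {fset G}) :
  ratio_in R [set x : {ffun 'I_k -> G} | forall i, C i (x i)] (pow_fset F) =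
  \prod_i ratio_in R (C i) F.
Proof.
rewrite ratio_inE card_pow_fset.
rewrite (eq_count (a2 := fun x : {ffun 'I_k -> G} => [forall i, x i \in C i])); last first.
  move=> x; apply/idP/forallP; rewrite inE => H i; first by rewrite inE.
  by have := H i; rewrite inE.
rewrite (count_pow_fset (fun i x => x \in C i)) natr_prod natrX.
rewrite [RHS](eq_bigr (fun i => (count (mem (C i)) F)%:R / #|` F|%:R)).
  by rewrite prodf_div prodr_const card_ord.
by move=> i _; exact: ratio_inE.
Qed.

Lemma folner_pow (Phi : nat -> {fset G}) :
  folner R Phi -> folner R (fun N => pow_fset (Phi N)).
Proof.
move=> [Phi0 PhiF]; split=> [N|g].
  by rewrite -cardfs_gt0 card_pow_fset expn_gt0 cardfs_gt0 Phi0.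
rewrite [X in _ --> X](_ : 1 = \prod_(i < k) 1); last by rewrite big1.
rewrite (_ : (fun N => _) = (fun N =>
    \prod_i ratio_in R (translate (g i) [set` Phi N]) (Phi N))).
  by apply: cvg_big => [|i _]; [exact: mul_continuous|exact: PhiF].
apply/funext => N; rewrite -ratio_in_pow; apply: ratio_in_ext => x _; split.
  case=> y; rewrite /= mem_pow_fset => /forallP yF <- i.
  by exists (y i); [exact: yF|rewrite ffunE].
move=> xg; exists (x - g); last by rewrite addrC subrK.
rewrite /= mem_pow_fset; apply/forallP => i; have [y yF yx] := xg i.
by rewrite !ffunE -yx addrAC subrr add0r.
Qed.

Lemma doubles_pow (x : {ffun 'I_k -> G}) :
  doubles _ x <-> forall i, doubles G (x i).
Proof.
split=> [[y _ <-] i|xD]; first by exists (y i); rewrite // /doubling ffunE.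
have yP i := cid2 (xD i); exists [ffun i => s2val (yP i)] => //.
apply/ffunP => i; by rewrite /doubling !ffunE; case: (yP i).
Qed.

Lemma index_labels_pow T :
  index_labels G T -> index_labels {ffun 'I_k -> G} {ffun 'I_k -> T}.
Proof.
case=> p psurj pP; exists (fun x : {ffun 'I_k -> G} => [ffun i => p (x i)]) => [t|x y].
  exists [ffun i => sval (cid (psurj (t i)))].
  by apply/ffunP => i; rewrite !ffunE; case: cid.
rewrite doubles_pow; split=> [/ffunP E i|E].
  by have := E i; rewrite !ffunE => /pP.
by apply/ffunP => i; rewrite !ffunE; apply/pP; have := E i; rewrite !ffunE.
Qed.

Lemma kernel_labels_pow K :
  kernel_labels G K -> kernel_labels {ffun 'I_k -> G} {ffun 'I_k -> K}.
Proof.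
case=> c cinj cP; exists (fun t : {ffun 'I_k -> K} => [ffun i => c (t i)]) => [s t /ffunP E|x].
  by apply/ffunP => i; apply: cinj; have := E i; rewrite !ffunE.
split=> [/ffunP xx|[t <-]].
  have xK i : exists t, c t = x i by apply/cP; have := xx i; rewrite !ffunE.
  exists [ffun i => sval (cid (xK i))].
  by apply/ffunP => i; rewrite !ffunE; case: cid.
by apply/ffunP => i; rewrite !ffunE; apply/cP; exists (t i).
Qed.

End Power.

(** * Levels of an exhaustion with geometric growth *)

Section Levels.
Variables (T : choiceType) (X : nat -> {fset T}) (Q : nat).
Hypothesis Xmono : forall n x, x \in X n -> x \in X n.+1.
Hypothesis cardX : forall n, #|` X n| = (Q ^ n)%N.

(** The level of [x] is the least [n] with [x \in X n]. *)
Definition odd_level : set T :=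
  [set x | exists n, x \in X n.*2.+1 /\ x \notin X n.*2].

Lemma level_mono m n x : (m <= n)%N -> x \in X m -> x \in X n.
Proof. by move=> /subnK <- xm; elim: (n - m)%N => // d; exact: Xmono. Qed.

Lemma level_lt m n x : x \in X m -> x \notin X n -> (n < m)%N.
Proof. by move=> xm; apply: contraNltn => mn; apply: level_mono xm. Qed.

Lemma level_exists n x :
  (exists m, x \in X m) -> x \notin X n ->
  exists m, [/\ (n <= m)%N, x \in X m.+1 & x \notin X m].
Proof.
case=> m; elim: m => [|m IH] xm xn; first by have := level_lt xm xn.
have [xm'|xm'] := boolP (x \in X m); first exact: IH.
by exists m; split=> //; rewrite -ltnS (level_lt xm).
Qed.

(** Passing from [X (2N)] to [X (2N + 2)] adds [Q ^ (2N + 1) - Q ^ (2N)] elements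
    of odd level, and [Q + 1] times this is [Q ^ (2N + 2) - Q ^ (2N)], so the
    sum telescopes. *)
Lemma count_odd_level N :
  (Q.+1 * count (mem odd_level) (X N.*2)).+1 = (Q ^ N.*2)%N.
Proof.
elim: N => [|N IH].
  rewrite (_ : count _ _ = 0)%N ?muln0 //; apply/eqP; rewrite -leqn0 leqNgt -has_count.
  apply/hasPn => x x0; apply/negP; rewrite inE => -[n [_ xn]].
  by have := level_lt x0 xn.
rewrite doubleS.
(* [A] collects the odd levels below [2N + 1]; [B] is the level [2N + 1] *)
pose A : pred T := fun x => (x \in X N.*2) && (x \in odd_level).
pose B : pred T := fun x => (x \in X N.*2.+1) && (x \notin X N.*2).
have countA : count A (X N.*2.+2) = count (mem odd_level) (X N.*2).
  apply: (@count_eq_inj _ _ id); rewrite ?fset_uniq // => x xX.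
    by case/andP.
  by move=> xodd; exists x => //; split; [do 2!apply: Xmono|rewrite /A xX].
have countB : (count B (X N.*2.+2) + Q ^ N.*2 = Q ^ N.*2.+1)%N.
  rewrite -!cardX -[in RHS](count_predC (mem (X N.*2))) addnC.
  congr (_ + _)%N.
    rewrite -[LHS]count_predT; apply: (@count_eq_inj _ _ id); rewrite ?fset_uniq //.
      by move=> x xX _; split=> //; exact: Xmono.
    by move=> x _ xX; exists x.
  apply: (@count_eq_inj _ _ id); rewrite ?fset_uniq // => x xX.
    by case/andP.
  by move=> /= xn; exists x => //; split; [exact: Xmono|rewrite /B xX].
have -> : count (mem odd_level) (X N.*2.+2) = (count A (X N.*2.+2) + count B (X N.*2.+2))%N.
  rewrite -count_predUI [X in (_ + X)%N](_ : _ = 0)%N ?addn0; last first.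
    apply/eqP; rewrite -leqn0 leqNgt -has_count; apply/hasPn => x _ /=.
    by rewrite /A /B; case: (x \in X N.*2); rewrite ?andbF.
  apply: eq_in_count => x xX /=; apply/idP/orP; last first.
    by case=> [/andP[]//|/andP[x1 x0]]; rewrite inE; exists N.
  rewrite /A /B => xodd; rewrite xodd andbT; have [_|xN] := boolP (x \in X N.*2); first by left.
  right; rewrite andbT; move: xodd; rewrite inE => -[n [x1 x0]].
  suff <- : n = N by [].
  apply/eqP; rewrite eqn_leq -leq_double -ltnS -[(N <= n)%N]leq_double.
  by have := level_lt xX x0; have := level_lt x1 xN; lia.
rewrite countA !expnS in countB *; nia.
Qed.

Lemma cvg_odd_level (R : realType) : (1 < Q)%N ->
  ((count (mem odd_level) (X N.*2))%:R / (Q ^ N.*2)%:R : R) @[N --> \oo] -->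
    (Q.+1%:R^-1 : R).
Proof.
move=> Q1; have lim : ((1 - ((Q ^ 2) ^ N)%:R^-1) / Q.+1%:R : R) @[N --> \oo] -->
    (1 / Q.+1%:R : R).
  rewrite -[X in X / _]subr0; apply: cvgM; last exact: cvg_cst.
  apply: cvgB; [exact: cvg_cst|apply: cvg_invXn].
  by rewrite (ltn_trans Q1) // -[X in (X < _)%N]expn1 ltn_exp2l.
rewrite div1r in lim; apply: cvg_trans lim; apply: near_eq_cvg; near=> N.
rewrite -expnM mul2n -count_odd_level.
have q0 : ((Q.+1 * count (mem odd_level) (X N.*2)).+1)%:R != 0 :> R by rewrite pnatr_eq0.
have Q0 : Q.+1%:R != 0 :> R by rewrite pnatr_eq0.
rewrite -[(_ * _).+1]addn1 natrD natrM in q0 *.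
by field; rewrite nat1r q0 Q0.
Unshelve. all: by end_near. Qed.

End Levels.

(** * Index a power of two and trivial kernel: integer vectors *)

Section Intervals.
Variable R : realType.

Definition int_below (L : nat) : {fset int} := [fset x in map Posz (iota 0 L)]%fset.

Lemma mem_int_below L z : (z \in int_below L) = (0 <= z) && (z < L%:Z).
Proof.
rewrite inE /=; apply/mapP/andP => [[j]|[z0 zL]].
  by rewrite mem_iota add0n => /andP[_ jL] ->.
by exists `|z|%N; rewrite ?mem_iota; lia.
Qed.

Lemma card_int_below L : #|` int_below L| = L.
Proof.
rewrite -[RHS](size_iota 0) -(size_map Posz); apply: perm_size; apply: uniq_perm.
- exact: fset_uniq.
- by rewrite map_inj_uniq ?iota_uniq // => i j [].
by move=> x; rewrite !inE.
Qed.

Lemma ratio_translate_int_below g L : (0 < L)%N ->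
  1 - `|g|%N%:R / L%:R <= ratio_in R (translate g [set` int_below L]) (int_below L).
Proof.
move=> L0; rewrite lerBlDr addrC -lerBlDr -ratio_inC; last first.
  by rewrite -cardfs_gt0 card_int_below.
rewrite ratio_inE card_int_below ler_wpM2r ?invr_ge0 // ler_nat.
rewrite -[leqRHS](size_iota 0) -[leqRHS]count_predT.
(* the points whose translate by [- g] leaves the interval lie within [|g|] of
   one of its ends, and [f] is the distance to that end *)
pose f (z : int) : nat := if 0 <= g then `|z|%N else absz (L%:Z - 1 - z)%R.
apply: (@count_le_inj _ _ f); rewrite /f.
- exact: fset_uniq.
- by move=> x y; rewrite !mem_int_below; case: ifP; lia.
move=> x; rewrite mem_int_below /= => xL; rewrite in_setC => /negP xg; split=> //.
rewrite mem_iota add0n /= ltnNge; apply/negP => gx; apply: xg.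
rewrite inE; exists (x - g); last by rewrite addrC subrK.
by rewrite /= mem_int_below; move: gx; case: ifP; lia.
Qed.

Lemma folner_int_below L : (forall N, 0 < L N)%N ->
  ((L N)%:R^-1 : R) @[N --> \oo] --> (0 : R) -> folner R (fun N => int_below (L N)).
Proof.
move=> L0 Linf; split=> [N|g]; first by rewrite -cardfs_gt0 card_int_below.
apply: squeeze_cvgr _ (cvg_cst (1 : R)); first last.
- rewrite -[X in _ --> X]subr0; apply: cvgB; first exact: cvg_cst.
  by rewrite -(mulr0 `|g|%N%:R); apply: cvgM; [exact: cvg_cst|exact: Linf].
- near=> N; rewrite ratio_in_le1 andbT.
  exact: ratio_translate_int_below (L0 N).
Unshelve. all: by end_near. Qed.

Lemma ratio_half_int_below L : (0 < L)%N ->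
  ratio_in R (Defs.half [set` int_below L.*2]) (int_below L.*2) = 2^-1.
Proof.
move=> L0; rewrite ratio_inE card_int_below.
rewrite (_ : count _ _ = L).
  by rewrite -muln2 natrM invfM mulrA divff ?mul1r // pnatr_eq0 -lt0n.
rewrite -[RHS]card_int_below -[RHS]count_predT.
apply: (@count_eq_inj _ _ id); rewrite ?fset_uniq // => x.
  rewrite !mem_int_below /= inE /Defs.half /doubling /= mem_int_below; lia.
rewrite !mem_int_below => xL _; exists x; split => //.
  by rewrite mem_int_below; lia.
by rewrite inE /Defs.half /doubling /= mem_int_below; lia.
Qed.

Lemma index_int : index_labels int bool.
Proof.
exists (fun z => (2 %| z)%Z) => [[]|x y]; first by exists 0.
  by exists 1.
split=> [E|[z _]]; last by rewrite /doubling; lia.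
by exists ((x - y) %/ 2)%Z => //; rewrite /doubling; lia.
Qed.

Lemma kernel_int : kernel_labels int unit.
Proof.
exists (fun=> 0) => [[] [] //|x]; split=> [xx|[_ <-]]; last by rewrite addr0.
by exists tt; lia.
Qed.

(** Adding a fixed nonnegative number to [x < 2 ^ n] carries it past [2 ^ n] only
    into the beginning of the next dyadic interval. The length [2 ^ n./2] is
    unbounded, so that it eventually exceeds the number added, yet small enough
    for the zone to have density 0. *)
Definition carry_zone : set int :=
  [set z | exists n g, (g < 2 ^ n./2)%N /\ z = (2 ^ n + g)%N%:Z].

Lemma count_carry_zone N :
  (count (mem carry_zone) (int_below (2 ^ N.*2.+1)) <= 3 * 2 ^ N)%N.
Proof.
pose s := [seq (2 ^ n + g)%N%:Z | n <- iota 0 N.*2.+1, g <- iota 0 (2 ^ n./2)].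
apply: (@leq_trans (size s)).
  rewrite -size_filter; apply: uniq_leq_size; first by rewrite filter_uniq ?fset_uniq.
  move=> z; rewrite mem_filter mem_int_below.
  move=> /andP[/set_mem[n [g [gn ->]]] /andP[_ zN]].
  apply/allpairsPdep; exists n, g; rewrite !mem_iota !add0n gn; split=> //.
  rewrite /= -(ltn_exp2l _ _ (isT : 1 < 2)%N).
  by apply: leq_ltn_trans (leq_addr g _) _.
rewrite size_allpairs_dep (eq_map (fun n => size_iota 0 (2 ^ n./2))).
rewrite sumnE big_map -[N.*2.+1]subn0 -/(index_iota _ _).
elim: N {s} => [|N IH]; first by rewrite big_nat1.
rewrite doubleS 2?big_nat_recr //= uphalf_double doubleK.
by rewrite !expnS; lia.
Qed.

Lemma cvg_carry_zone :
  ratio_in R carry_zone (int_below (2 ^ N.*2.+1)) @[N --> \oo] --> (0 : R).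
Proof.
have lim : (3 / 2 * (2 ^ N)%:R^-1 : R) @[N --> \oo] --> (0 : R).
  by rewrite -(mulr0 (3 / 2)); apply: cvgM; [exact: cvg_cst|exact: cvg_invXn].
apply: (squeeze_cvgr _ (cvg_cst 0) lim).
near=> N; rewrite ratio_in_ge0 /= ratio_inE card_int_below.
rewrite ler_pdivrMr ?ltr0n ?expn_gt0 //.
have -> : 3 / 2 * (2 ^ N)%:R^-1 * (2 ^ N.*2.+1)%:R = (3 * 2 ^ N)%:R :> R.
  rewrite expnS -addnn expnD !natrM.
  by field; rewrite pnatr_eq0 expn_eq0.
by rewrite ler_nat count_carry_zone.
Unshelve. all: by end_near. Qed.

End Intervals.

Section IntegerVectors.
Variables (R : realType) (k : nat).
Hypothesis k_gt0 : (0 < k)%N.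
Let G := {ffun 'I_k -> int}.
Let Q := (2 ^ k)%N.
Definition dyadic_box n : {fset G} := pow_fset k (int_below (2 ^ n)).
Local Notation X := dyadic_box.

Let mem_X n (x : G) : (x \in X n) = [forall i, (0 <= x i) && (x i < (2 ^ n)%N%:Z)].
Proof. by rewrite mem_pow_fset; apply: eq_forallb => i; rewrite mem_int_below. Qed.

Let X_mono n (x : G) : x \in X n -> x \in X n.+1.
Proof.
rewrite !mem_X => /forallP xX; apply/forallP => i; have := xX i.
by rewrite expnS; lia.
Qed.

Let card_X n : #|` X n| = (Q ^ n)%N.
Proof. by rewrite card_pow_fset card_int_below -!expnM mulnC. Qed.

Let X_exhausts (x : G) : (forall i, 0 <= x i) -> exists n, x \in X n.
Proof.
move=> x0; exists (\sum_i `|x i|)%N; rewrite mem_X; apply/forallP => i.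
rewrite x0 /= -[x i]gez0_abs // ltz_nat; apply: leq_ltn_trans (ltn_expl _ _) => //.
by rewrite (bigD1 i) //= leq_addr.
Qed.

Let X_double n (x : G) : (x + x \in X n.+1) = (x \in X n).
Proof.
rewrite !mem_X; apply: eq_forallb => i; rewrite ffunE expnS; move: (2 ^ n)%N (x i) => L z. lia.
Qed.

Definition doubled_odd_level : set G := @doubling G @` odd_level X.

Definition negative_vectors : set G := [set x | exists i, x i < 0].

Definition carry_vectors : set G := [set x | exists i, carry_zone (x i)].

(** The first set has the density prescribed for [C]; the second has density 0,
    and the third is disjoint from the boxes. *)
Definition integer_avoided : set G :=
  doubled_odd_level `|` (carry_vectors `|` negative_vectors).

(** If [B + B] misses the set then all elements of [B] are nonnegative and
    infinitely many of them agree modulo 2G. For two of these, [x] of large level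
    [m + 1] and [y] fixed, no coordinate of [x + y] is carried past [2 ^ (m + 1)],
    so [x + y] is the double of an element of level [m], while [x + x] is the
    double of [x], of level [m + 1]. One of the two levels is odd. *)
Lemma sumset_meets_integer_avoided (B : set G) : infinite_set B ->
  exists x y, [/\ B x, B y & integer_avoided (x + y)].
Proof.
move=> Binf; apply: contrapT => H.
have avoids x y : B x -> B y -> ~ integer_avoided (x + y).
  by move=> Bx By Cxy; apply: H; exists x, y.
have B0 x : B x -> forall i, 0 <= x i.
  move=> Bx i; rewrite leNgt; apply/negP => xi; apply: (avoids x x) => //.
  by right; right; exists i; rewrite ffunE; move: (x i) xi => c; lia.
have [p _ pP] := index_labels_pow k index_int.
have [t tinf] : exists t, infinite_set (B `&` [set x | p x = t]).
  apply: contrapT => /forallNP fin; apply: Binf.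
  apply: (@sub_finite_set _ _ (\bigcup_(t in setT) (B `&` [set x | p x = t]))).
    by move=> x Bx; exists (p x).
  apply: bigcup_finite => [|t _]; first exact: finite_finset.
  by apply: contrapT; exact: fin.
have [y [By yt]] := infinite_setN0 tinf.
have [n yn] := X_exhausts (B0 y By).
have [x [[Bx xt] xn]] : exists x, (B `&` [set x | p x = t]) x /\ x \notin X n.*2.+1.
  apply: contrapT => /forallNP small; apply: tinf.
  apply: sub_finite_set (finite_fset (X n.*2.+1)) => x xB.
  by apply/negPn/negP => xn; exact: (small x).
have [m [nm xm1 xm]] := level_exists X_mono (X_exhausts (B0 x Bx)) xn.
have [z _ zxy] : doubles G (x + y).
  rewrite (_ : x + y = (x - y) + (y + y)); last by rewrite addrA addrNK.
  by apply: doublesD; [apply/pP; rewrite xt yt|exists y].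
rewrite /doubling in zxy.
have xym1 : x + y \in X m.+1.
  rewrite mem_X; apply/forallP => i; rewrite ffunE.
  have [x0 y0] := (B0 x Bx i, B0 y By i).
  rewrite addr_ge0 //= ltNge; apply/negP => carry.
  apply: (avoids x y) => //; right; left; exists i.
  move: yn; rewrite mem_X => /forallP/(_ i) /andP[_ yi].
  move: xm1; rewrite mem_X => /forallP/(_ i) /andP[_ xi].
  have gap : (2 ^ n <= 2 ^ (m.+1)./2)%N by rewrite leq_exp2l //; lia.
  exists m.+1, (absz (x i + y i - (2 ^ m.+1)%N%:Z)%R); rewrite ffunE.
  move: (x i) (y i) (2 ^ m.+1)%N (2 ^ n)%N (2 ^ (m.+1)./2)%N
    x0 y0 carry xi yi gap => a b M L g.
  by lia.
have zm : z \in X m by rewrite -X_double zxy.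
have xym : x + y \notin X m.
  apply: contra xm; rewrite !mem_X => /forallP xyX; apply/forallP => i.
  have := xyX i; rewrite ffunE.
  by move: (x i) (y i) (2 ^ m)%N (B0 x Bx i) (B0 y By i) => a b M; lia.
case: m => [|m] in nm xm1 xm xym1 zm xym *; first by [].
have zm' : z \notin X m by rewrite -X_double zxy.
have [j [Em|Em]] : exists j, m = j.*2 \/ m = j.*2.+1.
  by exists m./2; have := odd_double_half m; case: (odd m); lia.
- apply: (avoids x y) => //; left; exists z => //.
  by exists j; rewrite -Em.
- apply: (avoids x x) => //; left; exists x => //.
  by exists j.+1; rewrite doubleS -Em.
Qed.

Lemma ratio_doubled_odd_level N :
  ratio_in R doubled_odd_level (X N.*2.+1) =
  (count (mem (odd_level X)) (X N.*2))%:R / (Q ^ N.*2)%:R / Q%:R.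
Proof.
rewrite ratio_inE card_X expnS natrM invfM mulrA mulrAC.
congr (_%:R / _ / _); apply/esym; apply: (@count_eq_inj _ _ (@doubling G)).
- exact: fset_uniq.
- exact: fset_uniq.
- move=> x y _ _ /ffunP E; apply/ffunP => i; have := E i.
  by rewrite /doubling !ffunE; move: (x i) (y i) => a b; lia.
- move=> x xX /set_mem xodd; split; first by rewrite X_double.
  by apply/mem_set; exists x.
- move=> y yX /set_mem[x xodd xy]; exists x => //; split; last exact/mem_set.
  by rewrite -X_double -/(doubling x) xy.
Qed.

(** The complement is the box of vectors with all coordinates outside the carry
    zone, whose density is the product of densities that tend to 1. *)
Lemma cvg_carry_vectors :
  ratio_in R carry_vectors (X N.*2.+1) @[N --> \oo] --> (0 : R).
Proof.
pose lim := 1 - \prod_(i < k) (1 - 0) : R.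
have lim0 : lim = 0 by rewrite /lim big1 ?subrr // => i _; rewrite subr0.
rewrite -[X in _ --> X]lim0.
rewrite (_ : (fun N => _) = (fun N => 1 -
    \prod_(i < k) (1 - ratio_in R carry_zone (int_below (2 ^ N.*2.+1))))).
  apply: cvgB; first exact: cvg_cst.
  apply: cvg_big => [|i _]; first exact: mul_continuous.
  by apply: cvgB; [exact: cvg_cst|exact: cvg_carry_zone].
apply/funext => N; have I0 : int_below (2 ^ N.*2.+1) != fset0.
  by rewrite -cardfs_gt0 card_int_below expn_gt0.
under eq_bigr do rewrite -ratio_inC //.
rewrite -(ratio_in_pow _ (fun=> ~` carry_zone)) -ratio_inC.
  apply: ratio_in_ext => x _; split=> [[i xi] /(_ i)|] //.
  by move=> /existsNP[i /contrapT]; exists i.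
by rewrite -cardfs_gt0 card_X expn_gt0 expn_gt0.
Qed.

Lemma example_integer_vectors :
  doubling_example R {ffun 'I_k -> bool} {ffun 'I_k -> unit}
    (fun N => X N.*2.+1) integer_avoided.
Proof.
have Q0 : Q%:R != 0 :> R by rewrite pnatr_eq0 expn_eq0.
have card_T : #|{ffun 'I_k -> bool}| = Q by rewrite card_ffun card_bool card_ord.
have card_K : #|{ffun 'I_k -> unit}| = 1%N by rewrite card_ffun card_unit exp1n.
have best : best_ratio R {ffun 'I_k -> bool} {ffun 'I_k -> unit} = Q%:R^-1.
  rewrite /best_ratio card_T card_K div1r; apply: min_r.
  by rewrite invf_le1 ?ler1n ?ltr0n expn_gt0.
split.
- exact: countableP.
- apply/infinite_set_fsetP => n; exists (X n) => //.
  by rewrite card_X ltnW // ltn_expl // (ltn_exp2l 0).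
- exact: index_labels_pow index_int.
- exact: kernel_labels_pow kernel_int.
- apply: folner_pow; apply: folner_int_below => [N|]; first by rewrite expn_gt0.
  rewrite -[X in _ --> X](mulr0 2^-1).
  apply: cvg_trans (cvgM (cvg_cst (2^-1 : R)) (@cvg_invXn R 4 isT)).
  apply: near_eq_cvg; near=> N.
  by rewrite expnS -mul2n expnM natrM invfM.
- rewrite best; apply: cvg_near_cst; apply: nearW => N.
  rewrite (@ratio_in_ext R _ _ [set x : G | forall i,
      Defs.half [set` int_below (2 ^ N.*2.+1)] (x i)]) => [|x _].
    rewrite (ratio_in_pow R (fun=> Defs.half [set` int_below (2 ^ N.*2.+1)])).
    rewrite expnS mul2n ratio_half_int_below ?expn_gt0 //.
    by rewrite prodr_const card_ord natrX exprVn.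
  rewrite /Defs.half /= mem_pow_fset; split=> [/forallP H i|H].
    by have := H i; rewrite ffunE.
  by apply/forallP => i; have := H i; rewrite ffunE.
- rewrite best card_T card_K.
  have lim : ratio_in R doubled_odd_level (X N.*2.+1) @[N --> \oo] -->
      (Q%:R^-1 / (Q + 1)%:R : R).
    rewrite mulrC addn1; under eq_cvg do rewrite ratio_doubled_odd_level.
    apply: cvgM; last exact: cvg_cst.
    by apply: cvg_odd_level; [exact: X_mono|exact: card_X|rewrite (ltn_exp2l 0)].
  have lim' : (ratio_in R doubled_odd_level (X N.*2.+1) +
      ratio_in R carry_vectors (X N.*2.+1)) @[N --> \oo] --> (Q%:R^-1 / (Q + 1)%:R : R).
    by rewrite -[X in _ --> X]addr0; apply: cvgD lim cvg_carry_vectors.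
  apply: (squeeze_cvgr _ lim lim'); near=> N; apply/andP; split.
    by apply: ratio_in_mono => x _ xodd; left.
  apply: le_trans (ratio_inU_le _ _ _ _); apply: ratio_in_mono => x xX.
  case=> [?|[?|[i xi]]]; [by left|by right|].
  by move: xX; rewrite mem_X => /forallP/(_ i); rewrite leNgt xi.
- exact: sumset_meets_integer_avoided.
Unshelve. all: by end_near. Qed.

End IntegerVectors.

(** * Index one and kernel of order a power of two: powers of the Prüfer 2-group *)

Section Fractional.

Definition dyadic (n : nat) (x : rat) := x * (2 ^ n)%:R \is a Num.int.

Definition frac (x : rat) : rat := x - (Num.floor x)%:~R.

Lemma dyadicD n x y : dyadic n x -> dyadic n y -> dyadic n (x + y).
Proof. by rewrite /dyadic mulrDl => xn yn; rewrite rpredD. Qed.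

Lemma dyadicN n x : dyadic n (- x) = dyadic n x.
Proof. by rewrite /dyadic mulNr rpredN. Qed.

Lemma dyadic_int n (m : int) : dyadic n m%:~R.
Proof. by rewrite /dyadic rpredM // ?rpred_int ?rpred_nat. Qed.

Lemma dyadic_mono m n x : (m <= n)%N -> dyadic m x -> dyadic n x.
Proof. by rewrite /dyadic => /subnK <- xm; rewrite expnD mulnC natrM mulrA rpredM // rpred_nat. Qed.

Lemma dyadic_frac n x : dyadic n (frac x) = dyadic n x.
Proof.
apply/idP/idP => xn; last by rewrite dyadicD // dyadicN dyadic_int.
by rewrite -[x](subrK (Num.floor x)%:~R) dyadicD // dyadic_int.
Qed.

Lemma frac_ge0_lt1 x : 0 <= frac x < 1.
Proof.
have /andP[lo hi] := floor_itv x.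
by rewrite /frac subr_ge0 lo ltrBlDr addrC -intrD1.
Qed.

Lemma frac_id x : 0 <= x < 1 -> frac x = x.
Proof. by move=> x01; rewrite /frac (@floor_def _ _ 0) ?subr0. Qed.

Lemma fracDz x (m : int) : frac (x + m%:~R) = frac x.
Proof.
rewrite /frac floorDrz ?intr_int // intrKfloor intrD.
by rewrite opprD addrACA subrr addr0.
Qed.

Lemma frac_eq x y : x - y \is a Num.int -> frac x = frac y.
Proof. by move=> /intrP[m E]; rewrite -(fracDz y m) -E addrC subrK. Qed.

Lemma fracDl x y : frac (frac x + y) = frac (x + y).
Proof.
apply: frac_eq; rewrite /frac opprD addrACA subrr addr0 addrAC subrr add0r.
by rewrite rpredN rpred_int.
Qed.

End Fractional.

(** The Prüfer 2-group is Z[1/2] / Z. Each class is represented by its dyadic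
    rational in the half-open unit interval, so that no quotient type is needed. *)
Record prufer := Prufer {
  prufer_val :> rat;
  _ : (0 <= prufer_val < 1) && `[< exists n, dyadic n prufer_val >] }.

HB.instance Definition _ := [isSub for prufer_val].
HB.instance Definition _ := [Countable of prufer by <:].

Section PruferGroup.
Implicit Types x y : prufer.

Lemma prufer_subproof (q : rat) n : dyadic n q ->
  (0 <= frac q < 1) && `[< exists n, dyadic n (frac q) >].
Proof.
by move=> qn; rewrite frac_ge0_lt1; apply/asboolP; exists n; rewrite dyadic_frac.
Qed.

Definition prufer_of (q : rat) (n : nat) (qn : dyadic n q) : prufer :=
  Prufer (prufer_subproof qn).

Lemma prufer_lt1 x : 0 <= val x < 1.
Proof. by case: x => q /= /andP[]. Qed.

Lemma prufer_dyadic x : exists n, dyadic n (val x).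
Proof. by case: x => q /= /andP[_ /asboolP]. Qed.

Lemma prufer_frac x : frac (val x) = val x.
Proof. exact/frac_id/prufer_lt1. Qed.

Lemma prufer_add_subproof x y : exists n, dyadic n (val x + val y).
Proof.
have [[m xm] [n yn]] := (prufer_dyadic x, prufer_dyadic y).
exists (m + n)%N; apply: dyadicD; first exact: dyadic_mono (leq_addr _ _) xm.
exact: dyadic_mono (leq_addl _ _) yn.
Qed.

Lemma prufer_opp_subproof x : exists n, dyadic n (- val x).
Proof. by have [n xn] := prufer_dyadic x; exists n; rewrite dyadicN. Qed.

Definition prufer_zero : prufer := prufer_of (dyadic_int 0 0).

Definition prufer_add x y : prufer := prufer_of (svalP (cid (prufer_add_subproof x y))).

Definition prufer_opp x : prufer := prufer_of (svalP (cid (prufer_opp_subproof x))).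

Lemma prufer_addA : associative prufer_add.
Proof.
move=> x y z; apply: val_inj => /=.
by rewrite fracDl addrC fracDl addrC addrA.
Qed.

Lemma prufer_addC : commutative prufer_add.
Proof. by move=> x y; apply: val_inj; rewrite /= addrC. Qed.

Lemma prufer_add0 : left_id prufer_zero prufer_add.
Proof. by move=> x; apply: val_inj; rewrite /= fracDl add0r prufer_frac. Qed.

Lemma prufer_addN : left_inverse prufer_zero prufer_opp prufer_add.
Proof. by move=> x; apply: val_inj; rewrite /= fracDl addNr. Qed.

HB.instance Definition _ := GRing.isZmodule.Build prufer
  prufer_addA prufer_addC prufer_add0 prufer_addN.

Lemma prufer_valD x y : val (x + y) = frac (val x + val y).
Proof. by []. Qed.

Lemma prufer_valN x : val (- x) = frac (- val x).
Proof. by []. Qed.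

Lemma dyadic_fraction n j : dyadic n (j%:R / (2 ^ n)%:R).
Proof. by rewrite /dyadic divfK ?pnatr_eq0 ?expn_eq0. Qed.

Definition prufer_fraction n j : prufer := prufer_of (dyadic_fraction n j).

Lemma prufer_fraction_val n j : (j < 2 ^ n)%N ->
  val (prufer_fraction n j) = j%:R / (2 ^ n)%:R.
Proof.
move=> jn; rewrite /= frac_id // divr_ge0 //=.
by rewrite ltr_pdivrMr ?ltr0n ?expn_gt0 // mul1r ltr_nat.
Qed.

Definition prufer_torsion n : {fset prufer} :=
  [fset x in map (prufer_fraction n) (iota 0 (2 ^ n))]%fset.

Lemma prufer_torsionP n x :
  reflect (exists2 j, (j < 2 ^ n)%N & x = prufer_fraction n j)
    (x \in prufer_torsion n).
Proof.
rewrite inE /=; apply: (iffP mapP) => -[j jn ->]; exists j => //; move: jn;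
  by rewrite mem_iota add0n.
Qed.

Lemma mem_prufer_torsion n x : (x \in prufer_torsion n) = dyadic n (val x).
Proof.
apply/prufer_torsionP/idP => [[j jn ->]|xn].
  by rewrite prufer_fraction_val ?dyadic_fraction.
have p0 : 0 < (2 ^ n)%:R :> rat by rewrite ltr0n expn_gt0.
have [x0 x1] := andP (prufer_lt1 x).
have /natrP[j E] : val x * (2 ^ n)%:R \is a Num.nat by rewrite natrEint mulr_ge0 // andbT.
have jn : (j < 2 ^ n)%N by rewrite -(ltr_nat rat) -E gtr_pMl.
exists j => //; apply: val_inj; rewrite prufer_fraction_val // -E mulfK // lt0r_neq0.
Qed.

Lemma card_prufer_torsion n : #|` prufer_torsion n| = (2 ^ n)%N.
Proof.
rewrite -[RHS](size_iota 0) -(size_map (prufer_fraction n)); apply: perm_size.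
apply: uniq_perm; first exact: fset_uniq.
  rewrite map_inj_in_uniq ?iota_uniq // => i j; rewrite !mem_iota !add0n /=.
  move=> ip jp /(congr1 val); rewrite !prufer_fraction_val //.
  have p0 : (2 ^ n)%:R != 0 :> rat by rewrite pnatr_eq0 expn_eq0.
  by move=> /(congr1 (fun q => q * (2 ^ n)%:R)); rewrite !divfK // => /eqP; rewrite eqr_nat => /eqP.
by move=> x; rewrite !inE.
Qed.

Lemma prufer_torsionB n x y :
  x \in prufer_torsion n -> y \in prufer_torsion n -> x - y \in prufer_torsion n.
Proof.
rewrite !mem_prufer_torsion => xn yn.
by rewrite prufer_valD dyadic_frac dyadicD // prufer_valN dyadic_frac dyadicN.
Qed.

Lemma prufer_torsion_mono m n x :
  (m <= n)%N -> x \in prufer_torsion m -> x \in prufer_torsion n.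
Proof. by rewrite !mem_prufer_torsion; exact: dyadic_mono. Qed.

Lemma prufer_torsion_double n x :
  (x + x \in prufer_torsion n) = (x \in prufer_torsion n.+1).
Proof.
rewrite !mem_prufer_torsion prufer_valD dyadic_frac /dyadic -mulr2n.
by rewrite -[val x *+ 2]mulr_natr -mulrA -natrM expnS.
Qed.

Lemma index_prufer : index_labels prufer unit.
Proof.
exists (fun=> tt) => [[]|x y]; first by exists 0.
split=> // _; move: (x - y) => z; have [n zn] := prufer_dyadic z.
have hn : dyadic n.+1 (val z / 2).
  by rewrite /dyadic expnS natrM mulrA divfK.
exists (prufer_of hn) => //; apply: val_inj.
rewrite /doubling prufer_valD /= fracDl addrC fracDl.
by rewrite -splitr prufer_frac.
Qed.

Lemma kernel_prufer : kernel_labels prufer bool.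
Proof.
have val2 (b : bool) : val (prufer_fraction 1 b) = b%:R / 2.
  by rewrite prufer_fraction_val //; case: b.
exists (fun b : bool => prufer_fraction 1 b) => [b c|x].
  by move=> /(congr1 val); rewrite !val2; case: b; case: c.
have zero_torsion (y : prufer) : y = 0 <-> y \in prufer_torsion 0.
  rewrite mem_prufer_torsion /dyadic expn0 mulr1; split=> [->|]; first by [].
  move=> /intrP[m E]; apply: val_inj; rewrite -prufer_frac E.
  by rewrite -[m%:~R]add0r fracDz.
rewrite zero_torsion prufer_torsion_double; split=> [|[b <-]].
  by move=> /prufer_torsionP[[|[|j]] // _ ->]; [exists false|exists true].
by rewrite mem_prufer_torsion val2; exact: dyadic_fraction 1 b.
Qed.

End PruferGroup.

Section PruferPowers.
Variables (R : realType) (k : nat).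
Hypothesis k_gt0 : (0 < k)%N.
Let G := {ffun 'I_k -> prufer}.
Let Q := (2 ^ k)%N.

Definition torsion_box n : {fset G} := pow_fset k (prufer_torsion n).
Local Notation X := torsion_box.

Let X_mono n (x : G) : x \in X n -> x \in X n.+1.
Proof.
rewrite !mem_pow_fset => /forallP xX; apply/forallP => i.
exact: prufer_torsion_mono (leqnSn n) (xX i).
Qed.

Let card_X n : #|` X n| = (Q ^ n)%N.
Proof. by rewrite card_pow_fset card_prufer_torsion -!expnM mulnC. Qed.

Let X_zero n : (0 : G) \in X n.
Proof.
rewrite mem_pow_fset; apply/forallP => i.
by rewrite ffunE mem_prufer_torsion (dyadic_int n 0).
Qed.

Let X_sub n (x y : G) : x \in X n -> y \in X n -> x - y \in X n.
Proof.
rewrite !mem_pow_fset => /forallP xX /forallP yX; apply/forallP => i.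
by rewrite !ffunE; exact: prufer_torsionB.
Qed.

Let X_exhausts (x : G) : exists n, x \in X n.
Proof.
pose f i := sval (cid (prufer_dyadic (x i))).
exists (\sum_i f i)%N; rewrite mem_pow_fset; apply/forallP => i.
apply: (@prufer_torsion_mono (f i)); first by rewrite (bigD1 i) //= leq_addr.
by rewrite mem_prufer_torsion /f; case: cid.
Qed.

Let X_double n (x : G) : (x + x \in X n) = (x \in X n.+1).
Proof.
rewrite !mem_pow_fset; apply: eq_forallb => i.
by rewrite ffunE prufer_torsion_double.
Qed.

(** If [y] has smaller level than [x] then [x + y] has the level of [x], while the
    level of [x + x] is one less; one of the two is odd. *)
Lemma sumset_meets_odd_torsion (B : set G) : infinite_set B ->
  exists x y, [/\ B x, B y & odd_level X (x + y)].
Proof.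
move=> Binf; have [y By] := infinite_setN0 Binf.
have [n yn] := X_exhausts y.
have [x [Bx xn]] : exists x, B x /\ x \notin X n.+1.
  apply: contrapT => /forallNP small; apply: Binf.
  apply: sub_finite_set (finite_fset (X n.+1)) => x Bx.
  by apply/negPn/negP => xn; exact: (small x).
have [m [nm xm1 xm]] := level_exists X_mono (X_exhausts x) xn.
have ym : y \in X m by apply: (level_mono X_mono _ yn); apply: ltnW.
case: m => // m in nm xm1 xm ym *.
have [j [Em|Em]] : exists j, m.+1 = j.*2 \/ m = j.*2.
  by exists m.+1./2; have := odd_double_half m.+1; case: (odd m.+1); lia.
- exists x, y; split=> //; exists j; rewrite -Em; split.
    rewrite -[y]opprK X_sub // -sub0r X_sub //; exact: X_mono.
  by apply: contra xm => xym; rewrite -[x](addrK y) X_sub.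
- by exists x, x; split=> //; exists j; rewrite -Em !X_double.
Qed.

Lemma example_prufer_powers :
  doubling_example R {ffun 'I_k -> unit} {ffun 'I_k -> bool}
    (fun N => X N.*2) (odd_level X).
Proof.
have card_T : #|{ffun 'I_k -> unit}| = 1%N by rewrite card_ffun card_unit exp1n.
have card_K : #|{ffun 'I_k -> bool}| = Q by rewrite card_ffun card_bool card_ord.
have best : best_ratio R {ffun 'I_k -> unit} {ffun 'I_k -> bool} = 1.
  rewrite /best_ratio card_T card_K divr1; apply: min_l.
  by rewrite ler1n expn_gt0.
split.
- exact: countableP.
- apply/infinite_set_fsetP => n; exists (X n) => //.
  by rewrite card_X ltnW // ltn_expl // (ltn_exp2l 0).
- exact: index_labels_pow index_prufer.
- exact: kernel_labels_pow kernel_prufer.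
- apply: folner_tower => [//|n x y|x]; first exact: X_sub.
  have [n xn] := X_exhausts x; exists n => // m /= nm.
  by apply: (level_mono X_mono _ xn); rewrite -addnn (leq_trans nm) ?leq_addr.
- rewrite best; apply: cvg_near_cst; apply: nearW => N.
  by apply: (ratio_half_tower R (S := X)).
- rewrite best card_T card_K add1n div1r.
  under eq_cvg do rewrite ratio_inE card_X.
  by apply: cvg_odd_level; [exact: X_mono|exact: card_X|rewrite (ltn_exp2l 0)].
- exact: sumset_meets_odd_torsion.
Qed.

End PruferPowers.

(** * The theorem *)

Lemma card_elementary i : #|{: 'rV['F_2]_i}| = (2 ^ i)%N.
Proof. by rewrite card_mx card_Fp // mul1n. Qed.

Theorem theorem1p3 (R : realType) (l r : nat)
  (hl : exists i : nat, l = (2 ^ i)%N) (hr : exists j : nat, r = (2 ^ j)%N) :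
  exists (G : zmodType) (Phi : nat -> {fset G}) (A : set G),
    [/\ [set: G] #= [set: nat],
        cosets (doubles G) #= `I_l &
        doubling_ker G #= `I_r] /\
    [/\ folner R Phi,
        quasi_invariant R Phi &
        doubling_ratio R Phi = group_ratio R G] /\
    upper_density R Phi A = 1 - group_ratio R G / (l + r)%:R /\
    (forall B : set G, infinite_set B -> ~ (sumset B B `<=` A)).
Proof.
(* the elementary factor accounts for the common power of 2 of [l] and [r] *)
case: hl hr => i -> [j ->].
have [ij|ji|<-] := ltngtP i j.
- have k0 : (0 < j - i)%N by rewrite subn_gt0.
  have := theorem_of_example (example_elementary i (example_prufer_powers R k0)).
  rewrite !card_prod !card_ffun card_unit card_bool card_ord card_elementary.
  by rewrite exp1n mul1n -expnD subnK // ltnW.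
- have k0 : (0 < i - j)%N by rewrite subn_gt0.
  have := theorem_of_example (example_elementary j (example_integer_vectors R k0)).
  rewrite !card_prod !card_ffun card_unit card_bool card_ord card_elementary.
  by rewrite exp1n mul1n -expnD subnK // ltnW.
- have := theorem_of_example (example_elementary i (example_poly_F3 R)).
  by rewrite !card_prod card_unit card_elementary mul1n.
Qed.
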